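(* There is no asymptotically correct discrimination procedure for the class of stationary ergodic processes. That is, let $A=\{0,1\}$ and let $\mathcal{S}$ be the set of all stationary ergodic processes with values in $A$. Then there does not exist a family of mappings $D_n: A^n\times A^n\to\{0,1\}$, $n\in\mathbb{N}$, such that for all $\rho_x,\rho_y\in\mathcal{S}$ (including the case $\rho_x=\rho_y$), when the sequences $x_1,x_2,\dots$ and $y_1,y_2,\dots$ are generated independently of each other by $\rho_x$ and $\rho_y$ respectively, the following limit exists and satisfies $$\lim_{n\to\infty}\mathbf{E}_{\rho_x\times\rho_y}\, D_n\big((x_1,\dots,x_n),(y_1,\dots,y_n)\big)=\begin{cases}0 & \text{if } \rho_x=\rho_y,\\ 1 & \text{otherwise.}\end{cases}$$
   Context: Let $A=\{0,1\}$. A process (process distribution) is a probability distribution on the set $A^\infty$ of one-way infinite sequences over $A$ (with the product $\sigma$-algebra); stationarity and ergodicity are with respect to the shift. A discrimination procedure $D$ is a family of mappings $D_n:A^n\times A^n\to\{0,1\}$, $n\in\mathbb{N}$. It is asymptotically correct for a set $\mathcal{C}$ of process distributions if for any two distributions $\rho_x,\rho_y\in\mathcal{C}$ (possibly equal) independently generating the sequences $x_1,x_2,\dots$ and $y_1,y_2,\dots$ respectively, the limit $\lim_{n\to\infty}\mathbf{E}D_n((x_1,\dots,x_n),(y_1,\dots,y_n))$ exists and equals $0$ if $\rho_x=\rho_y$ and $1$ otherwise. Here $\mathbf{E}=\mathbf{E}_{\rho_x\times\rho_y}$ is expectation with respect to the product measure $\rho_x\times\rho_y$. *)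

(* Defs.v *)
From mathcomp Require Import all_boot all_order all_algebra.
From mathcomp Require Import all_classical all_reals all_analysis.
From mathcomp Require Import giry.

Set Implicit Arguments.
Unset Strict Implicit.
Unset Printing Implicit Defensive.

Import Order.TTheory GRing.Theory Num.Theory.
Import numFieldNormedType.Exports.

Local Open Scope classical_set_scope.
Local Open Scope ring_scope.

(* The product sigma-algebra on the set of one-way infinite binary sequences
   is generated by the preimages of the coordinate projections; x_1, x_2, ...
   are x 0, x 1, ... *)
Definition coord_sets : set (set (nat -> bool)) :=
  [set A | exists i : nat, exists2 B : set bool,
     measurable B & A = (fun x : nat -> bool => x i) @^-1` B].

Definition binseq := g_sigma_algebraType coord_sets.

Definition shift_seq (x : binseq) : binseq := fun i : nat => x i.+1.

Definition first_n (n : nat) (x : binseq) : n.-tuple bool := [tuple x i | i < n].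

Definition discrimination_procedure : Type :=
  forall n : nat, n.-tuple bool -> n.-tuple bool -> bool.

Definition process (R : realType) := probability binseq R.

Section Processes.
Variable R : realType.
Local Open Scope ereal_scope.

Definition stationary (P : process R) : Prop :=
  forall A : set binseq, measurable A -> P (shift_seq @^-1` A) = P A.

Definition ergodic (P : process R) : Prop :=
  forall A : set binseq, measurable A -> shift_seq @^-1` A = A ->
    P A = 0 \/ P A = 1.

Definition stationary_ergodic : set (process R) :=
  [set P | stationary P /\ ergodic P].

Definition mean_output (D : discrimination_procedure) (Px Py : process R)
    (n : nat) : \bar R :=
  'E_(Px \x Py)[fun w : binseq * binseq =>
                  (D n (first_n n w.1) (first_n n w.2))%:R].

(* Distributions are compared with ≡μ, equality on measurable sets: a library
   measure is a function on all sets, and Leibniz equality would also compare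
   its irrelevant values on non-measurable ones. *)
Definition asymptotically_correct (D : discrimination_procedure)
    (C : set (process R)) : Prop :=
  forall Px Py : process R, C Px -> C Py ->
    (mean_output D Px Py n @[n --> \oo] --> if `[< Px ≡μ Py >] then 0 else 1).

End Processes.

(* Main.v *)
Require Import Defs.
From HB Require Import structures.
From mathcomp Require Import all_boot all_order all_algebra.
From mathcomp Require Import all_classical all_reals all_analysis.
From mathcomp Require Import giry.
From mathcomp Require Import zify ring lra.

(** The class of stationary ergodic processes is closed under a diagonal
    construction that defeats every candidate procedure [D].

    A process is handled through its marginals, the function giving the
    probability of each cylinder.  A nonempty word [w] read cyclically, with a
    uniform starting point, gives a stationary ergodic process with marginals
    [freq w]; these periodic processes are the building blocks.

    Suppose [D] is asymptotically correct.  Let [w] be a word and let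
    [Q = w^a c] be a long power of [w] with one more letter, chosen so that [Q]
    has another density of ones.  The processes of [w] and [Q] are close, yet
    different, so for some large [m] the procedure answers 1 on samples of
    length [m] coming from [w] and [Q] with probability at least 3/4.  The word
    [w' = w^A Q^B], with both halves of the same huge length, is a single
    periodic process, hence ergodic, but on windows of length [m] it looks like
    the mixture of [w] and [Q] with weights 1/2: of two independent samples, the
    first falls on the half of [w] and the second on the half of [Q] with
    probability close to 1/4.  So [D] answers 1 with probability at least 1/8
    on two independent samples of length [m] of the same process [w']
    ([fooling_perturbation]), although [w'] is as close to [w] as desired.

    Iterating with summable errors gives words [w_0, w_1, ...] whose marginals
    converge to some [f], so fast that on windows of length [m_k] the limit
    still behaves like [w_k], and [D] answers 1 with probability at least 1/16
    on infinitely many lengths ([fooling_limit]).  The limit is stationary.  It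
    is ergodic because in a sample of [w_k] the empirical frequency of any word
    among [size w_k] consecutive windows is exactly its probability, so under
    [f] the empirical frequencies converge in mean, along the lengths
    [size w_k], to constants; an invariant event is then independent of every
    cylinder ([ergodic_marginals]), in particular of itself.

    Such an [f] is realized by an actual process
    ([realization]): nested subintervals of the unit interval with lengths
    given by [f] turn a uniform point into a random sequence.  Applying [D] to
    two independent copies of this process contradicts its correctness. *)

Set Implicit Arguments.
Unset Strict Implicit.
Unset Printing Implicit Defensive.

Import Order.TTheory GRing.Theory Num.Theory.
Import numFieldNormedType.Exports.

Local Open Scope classical_set_scope.
Local Open Scope ring_scope.

(** * Windows of a sequence *)

Definition window (x : nat -> bool) (i n : nat) : seq bool :=
  [seq x j | j <- iota i n].

Lemma size_window x i n : size (window x i n) = n.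
Proof. by rewrite size_map size_iota. Qed.

Lemma window_tupleP x i n : size (window x i n) == n.
Proof. by rewrite size_window. Qed.
Canonical window_tuple x i n := Tuple (window_tupleP x i n).

Lemma windowSr x i n : window x i n.+1 = rcons (window x i n) (x (i + n)%N).
Proof. by rewrite /window -addn1 iotaD map_cat cats1. Qed.

Lemma windowS x i n : window x i n.+1 = x i :: window x i.+1 n.
Proof. by []. Qed.

Lemma eq_window x y i k n :
  (forall j, (j < n)%N -> x (i + j)%N = y (k + j)%N) ->
  window x i n = window y k n.
Proof.
elim: n i k => // n IH i k xy; rewrite !windowS; congr cons.
  by have := xy 0%N isT; rewrite !addn0.
by apply: IH => j jn; rewrite !addSnnS; apply: xy.
Qed.

Lemma sub_window x i n j m : (j + m <= n)%N ->
  take m (drop j (window x i n)) = window x (i + j) m.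
Proof.
by move=> jmn; rewrite /window -map_drop drop_iota -map_take take_iota; congr map; congr iota; lia.
Qed.

(** * Marginals and their total variation distance *)

Section Marginals.
Variable R : realFieldType.
Implicit Types (f g : seq bool -> R) (s u v w : seq bool).

(** The last two clauses are the compatibility of the marginals (summing out the
    last letter) and their stationarity (summing out the first one). *)
Definition marginals f : Prop :=
  [/\ f [::] = 1, forall s, 0 <= f s,
      forall s, f s = f (rcons s false) + f (rcons s true) &
      forall s, f s = f (false :: s) + f (true :: s)].

(** Twice the total variation distance of the laws of the first [n] letters. *)
Definition dist n f g : R := \sum_(t : n.-tuple bool) `|f t - g t|.

Lemma sum_tuple_rcons n (F : seq bool -> R) :
  \sum_(t : n.+1.-tuple bool) F t =
  \sum_(t : n.-tuple bool) (F (rcons t false) + F (rcons t true)).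
Proof.
pose h (p : n.-tuple bool * bool) : n.+1.-tuple bool := [tuple of rcons p.1 p.2].
pose h' (t : n.+1.-tuple bool) : n.-tuple bool * bool :=
  ([tuple of belast (thead t) (behead t)], last (thead t) (behead t)).
rewrite (reindex h) /=; last first.
  exists h' => [[t b] _|t _]; last first.
    by apply/val_inj; rewrite /= -lastI; case/tupleP: t => ? ?; rewrite theadE.
  have E : thead (h (t, b)) :: behead (h (t, b)) = rcons t b.
    by rewrite -[rcons t b]/(val (h (t, b))); case/tupleP: (h _).
  have := E; rewrite lastI => /rcons_inj [E1 E2].
  by rewrite /h' E2; congr pair; apply/val_inj.
rewrite (eq_bigr (fun p : n.-tuple bool * bool => F (rcons p.1 p.2))) //.
rewrite -(pair_big xpredT xpredT (fun (t : n.-tuple bool) b => F (rcons t b))) /=.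
by apply: eq_bigr => t _; rewrite big_bool addrC.
Qed.

Lemma sum_marginals f n : marginals f -> \sum_(t : n.-tuple bool) f t = 1.
Proof.
move=> [f0 _ fr _]; elim: n => [|n IH].
  rewrite (eq_bigr (fun=> 1)) => [|t _]; last by rewrite tuple0.
  by rewrite sumr_const card_tuple expn0.
by rewrite sum_tuple_rcons -IH; apply: eq_bigr => t _; rewrite -fr.
Qed.

Lemma dist_ge0 n f g : 0 <= dist n f g.
Proof. by apply: sumr_ge0. Qed.

Lemma distC n f g : dist n f g = dist n g f.
Proof. by apply: eq_bigr => t _; rewrite distrC. Qed.

Lemma dist_triangle n f g h : dist n f h <= dist n f g + dist n g h.
Proof. by rewrite /dist -big_split ler_sum// => t _; rewrite ler_distD. Qed.

(** Forgetting the last letter merges the words two by two, which can only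
    decrease an l1 distance. *)
Lemma dist_mono f g n m : marginals f -> marginals g -> (n <= m)%N ->
  dist n f g <= dist m f g.
Proof.
move=> [_ _ fr _] [_ _ gr _]; elim: m => [|m IH].
  by rewrite leqn0 => /eqP ->.
rewrite leq_eqVlt => /predU1P[-> //|]; rewrite ltnS => /IH /le_trans; apply.
rewrite [leRHS](sum_tuple_rcons m (fun s => `|f s - g s|)).
apply: ler_sum => t _; rewrite fr gr.
apply: le_trans (ler_normD _ _); rewrite le_eqVlt; apply/orP; left; apply/eqP.
by congr `|_|; ring.
Qed.

Lemma ler_dist n f g s : marginals f -> marginals g -> (size s <= n)%N ->
  `|f s - g s| <= dist n f g.
Proof.
move=> mf mg sn; apply: le_trans (dist_mono mf mg sn).
rewrite /dist (bigD1 (in_tuple s)) //= lerDl; exact: sumr_ge0.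
Qed.

(** The expectation of [D] on two independent samples of length [n]. *)
Definition mean n (D : n.-tuple bool -> n.-tuple bool -> bool) f g : R :=
  \sum_(s : n.-tuple bool) \sum_(t : n.-tuple bool) f s * g t * (D s t)%:R.

(** Replace the two independent samples one at a time: each replacement costs at
    most the distance. *)
Lemma mean_lipschitz n (D : n.-tuple bool -> n.-tuple bool -> bool) f g :
  marginals f -> marginals g ->
  mean D f f <= mean D g g + 2 * dist n f g.
Proof.
move=> mf mg; rewrite -lerBlDl.
have -> : 2 * dist n f g = \sum_(s : n.-tuple bool) \sum_(t : n.-tuple bool)
    (`|f s - g s| * f t + g s * `|f t - g t|).
  under [RHS]eq_bigr => s _ do rewrite big_split /= -!mulr_sumr.
  rewrite big_split /= -!mulr_suml !(sum_marginals _ mf) !(sum_marginals _ mg).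
  by rewrite /dist; ring.
rewrite /mean -sumrB ler_sum// => s _; rewrite -sumrB ler_sum// => t _.
have [[_ f0 _ _] [_ g0 _ _]] := (mf, mg).
have B0 : 0 <= `|f s - g s| * f t + g s * `|f t - g t|.
  by rewrite addr_ge0 ?mulr_ge0.
have B1 : f s * f t - g s * g t <= `|f s - g s| * f t + g s * `|f t - g t|.
  have -> : f s * f t - g s * g t = (f s - g s) * f t + g s * (f t - g t) by ring.
  by rewrite lerD ?ler_wpM2r ?ler_wpM2l ?ler_norm.
by case: (D s t) => /=; rewrite ?mulr1 ?mulr0 ?subrr.
Qed.

(** * Periodic processes *)

Definition cyc w (i : nat) : bool := nth false w (i %% size w).

Definition occ x p s : R := \sum_(i < p) (window x i (size s) == s)%:R.

(** The probability of [s] when [w] is read cyclically from a uniform position. *)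
Definition freq w s : R := occ (cyc w) (size w) s / (size w)%:R.

Lemma sum_occ x p n (h : seq bool -> R) :
  \sum_(t : n.-tuple bool) occ x p t * h t = \sum_(i < p) h (window x i n).
Proof.
under eq_bigr => t _ do rewrite /occ size_tuple mulr_suml.
rewrite exchange_big /=; apply: eq_bigr => i _.
rewrite (bigD1 [tuple of window x i n]) //= eqxx mul1r big1 ?addr0 //.
by move=> t; rewrite -val_eqE /= eq_sym => /negPf ->; rewrite mul0r.
Qed.

Lemma cyc_addn w i : cyc w (i + size w) = cyc w i.
Proof. by rewrite /cyc modnDr. Qed.

Lemma cyc_addMn w k i : cyc w (k * size w + i) = cyc w i.
Proof. by rewrite /cyc modnMDl. Qed.

(** Stationarity holds because moving every starting position by one only
    rotates the starting positions of the cycle. *)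
Lemma marginals_freq w : (0 < size w)%N -> marginals (freq w).
Proof.
move=> w0; have p0 : 0 < (size w)%:R :> R by rewrite ltr0n.
split.
- rewrite /freq /occ /= (eq_bigr (fun=> 1)) // sumr_const card_ord.
  by rewrite divff// gt_eqF.
- by move=> s; rewrite divr_ge0 ?sumr_ge0.
- move=> s; rewrite /freq -mulrDl; congr (_ / _); rewrite /occ -big_split /=.
  apply: eq_bigr => i _; rewrite !size_rcons windowSr !eqseq_rcons.
  by case: cyc; rewrite ?eqxx /= ?andbT ?andbF ?addr0 ?add0r.
- move=> s; rewrite /freq -mulrDl; congr (_ / _).
  have per : window (cyc w) (size w) (size s) = window (cyc w) 0 (size s).
    by apply: eq_window => j _; rewrite addnC cyc_addn add0n.
  rewrite {1}/occ.
  have -> : \sum_(i < size w) (window (cyc w) i (size s) == s)%:R =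
     \sum_(i < size w) (window (cyc w) i.+1 (size s) == s)%:R :> R.
    pose F i : R := (window (cyc w) i (size s) == s)%:R.
    have : \sum_(i < (size w).+1) F i = F 0%N + \sum_(i < size w) F i.+1.
      by rewrite big_ord_recl.
    rewrite big_ord_recr /= /F per addrC => /addrI; exact.
  rewrite /occ -big_split; apply: eq_bigr => i _ /=.
  rewrite !eqseq_cons -/(window _ _ _).
  by case: cyc; rewrite ?eqxx /= ?addr0 ?add0r.
Qed.

(** At most [n] of the first [p] positions start a window of length [n] that
    passes the position [p]; these are the boundary effects below. *)
Lemma count_tail p n : (\sum_(i < p) (p < i + n)%N <= n)%N.
Proof.
rewrite (reindex_inj rev_ord_inj) /=.
apply: (@leq_trans (\sum_(i < p) (i < n)%N)).
  by apply: leq_sum => i _; have := ltn_ord i; lia.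
have -> : (\sum_(i < p) (i < n) = minn p n)%N; last lia.
by elim: p => [|p IH]; rewrite ?big_ord0 ?big_ord_recr ?min0n //= IH; lia.
Qed.

(** Only the windows that pass the position [p] can differ, and each of them
    moves one unit of mass from one word to another. *)
Lemma dist_occ x y p n : (forall j, (j < p)%N -> x j = y j) ->
  dist n (occ x p) (occ y p) <= 2 * n%:R.
Proof.
move=> xy.
apply: (@le_trans _ _ (\sum_(i < p) 2 * (p < i + n)%:R)); last first.
  by rewrite -mulr_sumr -natr_sum ler_wpM2l ?ler_nat ?count_tail.
apply: (@le_trans _ _ (\sum_(t : n.-tuple bool) \sum_(i < p)
   `|(window x i n == t)%:R - (window y i n == t)%:R|)).
  apply: ler_sum => t _; rewrite /occ -sumrB size_tuple; exact: ler_norm_sum.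
rewrite exchange_big; apply: ler_sum => i _ /=.
case: ltnP => [_|le].
  have one z : \sum_(t : n.-tuple bool) (window z i n == t)%:R = 1 :> R.
    rewrite (bigD1 [tuple of window z i n]) //= eqxx big1 ?addr0 // => t.
    by rewrite -val_eqE /= eq_sym => /negPf ->.
  have two : 2 = \sum_(t : n.-tuple bool) (window x i n == t)%:R +
      \sum_(t : n.-tuple bool) (window y i n == t)%:R :> R by rewrite !one.
  rewrite mulr1 two -big_split /=; apply: ler_sum => t _.
  by apply: le_trans (ler_normB _ _) _; rewrite !ger0_norm ?ler0n /=.
rewrite mulr0 big1 // => t _; rewrite (@eq_window x y i i n) ?subrr ?normr0 //.
by move=> j jn; apply: xy; lia.
Qed.

(** The cycle of [u ++ v] sees the windows of the cycles of [u] and [v], but for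
    boundary effects at the two junctions. *)
Lemma dist_cat n u v :
  dist n (fun s => occ (cyc (u ++ v)) (size (u ++ v)) s)
    (fun s => occ (cyc u) (size u) s + occ (cyc v) (size v) s) <= 4 * n%:R.
Proof.
pose y j := cyc (u ++ v) (size u + j).
have E s : occ (cyc (u ++ v)) (size (u ++ v)) s =
    occ (cyc (u ++ v)) (size u) s + occ y (size v) s.
  rewrite /occ size_cat big_split_ord /=; congr (_ + _); apply: eq_bigr => i _.
  by rewrite (@eq_window (cyc (u ++ v)) y (size u + i) i) // => j _; rewrite /y addnA.
have -> : 4 * n%:R = 2 * n%:R + 2 * n%:R :> R by ring.
apply: le_trans (lerD (@dist_occ (cyc (u ++ v)) (cyc u) (size u) n _)
                      (@dist_occ y (cyc v) (size v) n _)).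
- rewrite /dist -big_split ler_sum// => t _; rewrite E.
  by apply: le_trans (ler_normD _ _); rewrite le_eqVlt; apply/orP; left; apply/eqP; congr `|_|; ring.
- by move=> j ju; rewrite /cyc size_cat !modn_small ?nth_cat ?ju//; lia.
- move=> j jv; rewrite /y /cyc size_cat !modn_small ?nth_cat; [|lia..].
  by rewrite ltnNge leq_addr /= addKn.
Qed.

Definition power w a := flatten (nseq a w).

Lemma size_power w a : size (power w a) = (a * size w)%N.
Proof. by rewrite size_flatten /shape map_nseq sumn_nseq mulnC. Qed.

Lemma nth_power w a j : (j < a * size w)%N ->
  nth false (power w a) j = cyc w j.
Proof.
elim: a j => // a IH j ja; rewrite /power /= nth_cat.
case: ltnP => jw; first by rewrite /cyc modn_small.
rewrite -/(power w a) IH; last by lia.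
by rewrite -[in RHS](subnK jw) cyc_addn.
Qed.

Lemma freq_power w a : (0 < size w)%N -> (0 < a)%N -> freq (power w a) =1 freq w.
Proof.
move=> w0 a0 s; rewrite /freq.
have -> : occ (cyc (power w a)) (size (power w a)) s = occ (cyc w) (a * size w) s.
  rewrite /occ size_power; apply: eq_bigr => i _.
  rewrite (@eq_window _ (cyc w) i i) // => j _.
  rewrite {1}/cyc size_power nth_power ?ltn_mod ?muln_gt0 ?a0 //.
  by rewrite [in RHS](divn_eq (i + j) (a * size w)) mulnA cyc_addMn.
have -> : occ (cyc w) (a * size w) s = a%:R * occ (cyc w) (size w) s.
  elim: {a0} a => [|a IH]; first by rewrite /occ mul0n big_ord0 mul0r.
  rewrite mulSn addnC {1}/occ big_split_ord /= -/(occ _ _ _) IH.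
  rewrite -natr1 mulrDl mul1r; congr (_ + _); apply: eq_bigr => i _.
  by rewrite (@eq_window _ (cyc w) _ i) // => j _; rewrite -addnA cyc_addMn.
have ? : (size w)%:R != 0 :> R by rewrite pnatr_eq0 -lt0n.
have ? : a%:R != 0 :> R by rewrite pnatr_eq0 -lt0n.
by rewrite size_power natrM; field; apply/andP.
Qed.

Lemma occ_freq w s : (0 < size w)%N ->
  occ (cyc w) (size w) s = (size w)%:R * freq w s.
Proof. by move=> w0; rewrite /freq mulrC divfK // pnatr_eq0 -lt0n. Qed.

(** Concatenating two words of the same length approximates the mixture of their
    processes, which is stationary but not ergodic, by an ergodic process. *)
Lemma dist_mix n u v : (0 < size u)%N -> size u = size v ->
  (size u)%:R * dist n (freq (u ++ v)) (fun s => (freq u s + freq v s) / 2)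
  <= 2 * n%:R.
Proof.
move=> u0 uv; have := dist_cat n u v.
rewrite /dist (eq_bigr (fun t : n.-tuple bool => 2 * ((size u)%:R *
   `|freq (u ++ v) t - (freq u t + freq v t) / 2|))) => [|t _].
  rewrite -!mulr_sumr; lra.
rewrite !occ_freq ?size_cat -?uv ?addn_gt0 ?u0 //.
have -> : 2 * ((size u)%:R * `|freq (u ++ v) t - (freq u t + freq v t) / 2|) =
  `|2 * (size u)%:R * (freq (u ++ v) t - (freq u t + freq v t) / 2)|.
  by rewrite normrM ger0_norm ?mulrA // mulr_ge0.
by congr `|_|; rewrite natrD; field.
Qed.

Lemma dist_le2 n f g : marginals f -> marginals g -> dist n f g <= 2.
Proof.
move=> mf mg; have -> : 2 = \sum_(t : n.-tuple bool) f t + \sum_(t : n.-tuple bool) g t.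
  by rewrite !sum_marginals.
rewrite -big_split; apply: ler_sum => t _ /=.
have [[_ f0 _ _] [_ g0 _ _]] := (mf, mg).
by apply: le_trans (ler_normB _ _) _; rewrite !ger0_norm.
Qed.

(** One more letter after many repetitions of [w] is hardly noticed. *)
Lemma dist_rcons n w a c : (0 < size w)%N -> (0 < a)%N ->
  (a * size w)%:R * dist n (freq (power w a ++ [:: c])) (freq w) <= 4 * n%:R + 2.
Proof.
move=> w0 a0; set Q := _ ++ _.
have sQ : size Q = (a * size w + 1)%N by rewrite size_cat size_power.
have mw := marginals_freq w0; have mc : marginals (freq [:: c]) by exact: marginals_freq.
have mQ : marginals (freq Q) by apply: marginals_freq; rewrite sQ addn1.
have H := dist_cat n (power w a) [:: c]; rewrite -/Q in H.
have H2 := dist_le2 n mc mw.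
apply: le_trans (lerD H H2).
apply: (@le_trans _ _ ((size Q)%:R * dist n (freq Q) (freq w))).
  by rewrite ler_wpM2r ?dist_ge0 // sQ natrD lerDl.
rewrite /dist mulr_sumr -big_split ler_sum// => t _ /=.
rewrite !occ_freq ?sQ ?size_power ?addn1 ?muln_gt0 ?a0 // freq_power //.
rewrite -{1}[_%:R]ger0_norm // -normrM; apply: le_trans (ler_normD _ _).
rewrite le_eqVlt; apply/orP; left; apply/eqP; congr `|_|.
by rewrite -natr1 /=; ring.
Qed.

Lemma freq_true w : freq w [:: true] = (count id w)%:R / (size w)%:R.
Proof.
rewrite /freq /occ; congr (_ / _); rewrite -natr_sum; congr _%:R.
rewrite -sum1_count [RHS]big_mkcond /= [RHS](big_nth false) big_mkord; apply: eq_bigr => i _.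
have -> : window (cyc w) i (size [:: true]) = [:: nth false w i].
  by rewrite /window /= /cyc modn_small.
by case: nth.
Qed.

(** A letter whose addition changes the density of ones: 0 if [w] consists of
    ones only, and 1 otherwise. *)
Lemma freq_rcons_neq w a : (0 < size w)%N ->
  exists c, freq w [:: true] != freq (power w a ++ [:: c]) [:: true].
Proof.
move=> w0; exists (~~ all id w); rewrite !freq_true size_cat size_power /=.
rewrite eqr_div ?pnatr_eq0 ?addn1 -?lt0n // -!natrM eqr_nat count_cat /=.
have -> : count id (power w a) = (a * count id w)%N.
  by elim: a => //= a IH; rewrite count_cat -/(power w a) IH mulSn.
rewrite all_count.
have := count_size id w.
by case: eqP => /= E le; apply/eqP; nia.
Qed.

End Marginals.

(** * A perturbation that fools the procedure *)

Section Fooling.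
Variable R : realType.
Implicit Types (f g : seq bool -> R) (s u v w : seq bool).

Lemma large_multiple (c e : R) : 0 < e ->
  exists2 a, (0 < a)%N & c <= e * a%:R.
Proof.
move=> e0; exists (Num.bound (`|c| / e)).+1 => //.
have /ltW := archi_boundP (divr_ge0 (normr_ge0 c) (ltW e0)).
rewrite ler_pdivrMr // mulrC => /(le_trans (ler_norm c)) /le_trans; apply.
by rewrite ler_pM2l// ler_nat.
Qed.

Lemma marginals_mix f g : marginals f -> marginals g ->
  marginals (fun s => (f s + g s) / 2).
Proof.
move=> [f1 f0 fr fl] [g1 g0 gr gl]; split.
- by rewrite f1 g1; field.
- by move=> s; rewrite divr_ge0 ?addr_ge0.
- by move=> s; rewrite fr gr; field.
- by move=> s; rewrite fl gl; field.
Qed.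

(** With probability 1/4 the first sample comes from [f] and the second from
    [g]. *)
Lemma mean_le_mix n (D : n.-tuple bool -> n.-tuple bool -> bool) f g :
  marginals f -> marginals g ->
  mean D f g <= 4 * mean D (fun s => (f s + g s) / 2) (fun s => (f s + g s) / 2).
Proof.
move=> [_ f0 _ _] [_ g0 _ _]; rewrite mulr_sumr ler_sum// => s _.
rewrite mulr_sumr ler_sum// => t _; rewrite mulrA ler_wpM2r//.
have -> : 4 * ((f s + g s) / 2 * ((f t + g t) / 2)) =
  f s * g t + (f s * f t + g s * f t + g s * g t) by field.
by rewrite lerDl !addr_ge0 ?mulr_ge0.
Qed.

Lemma dist_mixr n f g : dist n f (fun s => (f s + g s) / 2) = dist n f g / 2.
Proof.
rewrite /dist mulr_suml; apply: eq_bigr => t _.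
have -> : f t - (f t + g t) / 2 = (f t - g t) / 2 by field.
by rewrite normrM (ger0_norm (_ : 0 <= 2^-1)).
Qed.

Lemma eq_dist n f f' g g' : f =1 f' -> g =1 g' -> dist n f g = dist n f' g'.
Proof. by move=> ff gg; apply: eq_bigr => t _; rewrite ff gg. Qed.

(** All that asymptotic correctness is used for on periodic processes. *)
Definition separates (D : forall n, n.-tuple bool -> n.-tuple bool -> bool) :=
  forall u v, (0 < size u)%N -> (0 < size v)%N ->
    freq R u [:: true] != freq R v [:: true] ->
  forall N, exists2 m, (N <= m)%N & 3 / 4 <= mean (D m) (freq R u) (freq R v).

(** The heart of the proof: arbitrarily close to a periodic process there is
    another one on which the procedure wrongly answers 1 with probability at
    least 1/8, as its samples come from two distinguishable halves. *)
Lemma fooling_perturbation D w n (e : R) : separates D ->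
  (0 < size w)%N -> 0 < e ->
  exists w' m, [/\ (0 < size w')%N, (n <= m)%N,
    dist n (freq R w) (freq R w') <= e &
    1 / 8 <= mean (D m) (freq R w') (freq R w')].
Proof.
move=> sepD w0 e0.
have [a a0 ha] := large_multiple (4 * n%:R + 2) e0.
have [c wQ] := freq_rcons_neq R a w0; set Q := power w a ++ [:: c] in wQ.
have Q0 : (0 < size Q)%N by rewrite size_cat addn1.
have [m nm hm] := sepD _ _ w0 Q0 wQ n.
have [t1 t10 ht1] : exists2 t, (0 < t)%N & 2 * n%:R <= e / 2 * t%:R.
  by apply: large_multiple; rewrite divr_gt0.
have [t2 t20 ht2] : exists2 t, (0 < t)%N & 2 * m%:R <= 32^-1 * t%:R :> R.
  by apply: large_multiple; rewrite invr_gt0.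
(* The mixture must be good on windows of length n, to stay close to w, and of
   length m, to keep the answers of the procedure: t serves both. *)
pose t := (t1 + t2)%N; have t0 : (0 < t)%N by rewrite /t; lia.
(* The exponents make the two halves equally long. *)
pose A := (size Q * t)%N; pose B := (size w * t)%N.
have [A0 B0] : (0 < A)%N /\ (0 < B)%N by rewrite !muln_gt0 Q0 w0 t0.
pose u := power w A; pose v := power Q B.
have uv : size u = size v by rewrite !size_power /A /B; nia.
have tu : (t <= size u)%N by rewrite size_power /A; nia.
have u0 : (0 < size u)%N by lia.
pose mix s : R := (freq R w s + freq R Q s) / 2.
have [mw mQ] := (marginals_freq R w0, marginals_freq R Q0).
have mmix : marginals mix := marginals_mix mw mQ.
have close k (d : R) : 2 * k%:R <= d * t%:R -> dist k mix (freq R (u ++ v)) <= d.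
  move=> kd; have d0 : 0 <= d.
    have : 0 <= d * t%:R by apply: le_trans kd; rewrite mulr_ge0.
    by rewrite pmulr_lge0 // ltr0n.
  have := le_trans (dist_mix R k u0 uv) kd.
  rewrite distC (@eq_dist _ mix (fun s => (freq R u s + freq R v s) / 2)
    (freq R (u ++ v)) (freq R (u ++ v))) // => [|s]; last first.
    by rewrite /mix -(freq_power R w0 A0) -(freq_power R Q0 B0).
  rewrite distC => h; rewrite -(ler_pM2l (_ : 0 < (size u)%:R)) ?ltr0n //.
  by apply: le_trans h _; rewrite mulrC ler_wpM2r// ler_nat.
exists (u ++ v), m; split => //; first by rewrite size_cat addn_gt0 u0.
- apply: le_trans (dist_triangle n _ mix _) _; rewrite dist_mixr.
  have -> : e = e / 2 + e / 2 by field.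
  apply: lerD; last first.
    by apply: close; apply: le_trans ht1 _; rewrite ler_wpM2l ?divr_ge0 ?(ltW e0)// ler_nat leq_addr.
  rewrite ler_pM2r// distC -(ler_pM2l (_ : 0 < a%:R)) ?ltr0n //.
  rewrite [leRHS]mulrC; apply: le_trans ha.
  apply: le_trans (dist_rcons R n c w0 a0).
  by rewrite ler_wpM2r ?dist_ge0 // ler_nat leq_pmulr.
- have cm : dist m mix (freq R (u ++ v)) <= 32^-1.
    by apply: close; apply: le_trans ht2 _; rewrite ler_wpM2l ?invr_ge0// ler_nat leq_addl.
  have muv : marginals (freq R (u ++ v)).
    by apply: marginals_freq; rewrite size_cat addn_gt0 u0.
  (* 3/16 for the mixture, minus 1/16 for its approximation. *)
  have := mean_lipschitz (D m) mmix muv; have := mean_le_mix (D m) mw mQ.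
  rewrite -/mix; lra.
Qed.

(** * Empirical frequencies *)

(** The proportion of occurrences of [s] among the first [m] windows of [t]. *)
Definition empirical m s (t : seq bool) : R :=
  (\sum_(i < m) (take (size s) (drop i t) == s)%:R) / m%:R.

(** At suitable lengths the empirical frequencies are close in mean to constants.
    This form of ergodicity only involves finite sums, so it can be checked on
    an approximation of [f]. *)
Definition empirically_ergodic f := forall s (e : R), 0 < e ->
  exists2 m, (0 < m)%N & 
    \sum_(t : (m + size s).-tuple bool) f t * `|empirical m s t - f s| <= e.

Lemma empirical_window m s x i :
  empirical m s (window x i (m + size s)) = occ R (fun j => x (i + j)%N) m s / m%:R.
Proof.
congr (_ / _); apply: eq_bigr => j _; rewrite sub_window; last first.
  by have := ltn_ord j; lia.
by rewrite (@eq_window x (fun j => x (i + j)%N) (i + j) j) // => k _; rewrite addnA.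
Qed.

Lemma empirical01 m s t : 0 <= empirical m s t <= 1.
Proof.
case: m => [|m].
  by rewrite /empirical big_ord0 mul0r lexx ler01.
rewrite divr_ge0 ?sumr_ge0//= ler_pdivrMr ?ltr0n// mul1r.
rewrite -natr_sum ler_nat -[leqRHS]card_ord -sum1_card leq_sum// => i _.
by case: eqP.
Qed.

(** A full turn of the cycle sees the same windows wherever it starts. *)
Lemma occ_cyc_shift w i s :
  occ R (fun j => cyc w (i + j)) (size w) s = occ R (cyc w) (size w) s.
Proof.
have step : forall k, occ R (fun j => cyc w (k.+1 + j)) (size w) s =
    occ R (fun j => cyc w (k + j)) (size w) s.
  move=> k; pose F j : R := (window (cyc w) (k + j) (size s) == s)%:R.
  have E l : occ R (fun j => cyc w (k + l + j)) (size w) s =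
      \sum_(j < size w) F (l + j)%N.
    apply: eq_bigr => j _; rewrite /F.
    by congr (_ == _)%:R; apply: eq_window => h _; congr cyc; lia.
  have := E 1%N; rewrite addn1 => ->; have := E 0%N; rewrite addn0 => ->.
  have per : F (size w) = F 0%N.
    rewrite /F (@eq_window _ (cyc w) _ (k + 0)) // => j _.
    by rewrite addnAC cyc_addn addn0.
  have : \sum_(j < (size w).+1) F j = F 0%N + \sum_(j < size w) F (1 + j)%N.
    by rewrite big_ord_recl.
  rewrite big_ord_recr /= per addrC => /addrI <-.
  by apply: eq_bigr => j _; rewrite add0n.
by elim: i => [|i IH]; rewrite ?step.
Qed.

(** Any [size w] consecutive windows of the periodic sequence form a full turn,
    so the empirical frequency is deterministic. *)
Lemma empirical_freq w s : (0 < size w)%N ->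
  \sum_(t : (size w + size s).-tuple bool)
    freq R w t * `|empirical (size w) s t - freq R w s| = 0.
Proof.
move=> w0; under eq_bigr => t _ do rewrite {1}/freq -mulrA [_^-1 * _]mulrC mulrA.
rewrite -mulr_suml (sum_occ _ _ _ (fun t => `|empirical (size w) s t - freq R w s|)).
rewrite big1 ?mul0r // => i _.
by rewrite empirical_window occ_cyc_shift -/(freq R w s) subrr normr0.
Qed.

(** One copy of the distance pays for averaging under [f] instead of [freq w],
    the other one for replacing the centering constant. *)
Lemma empirical_transfer w f s : (0 < size w)%N -> marginals f ->
  \sum_(t : (size w + size s).-tuple bool) f t * `|empirical (size w) s t - f s|
  <= 2 * dist (size w + size s) (freq R w) f.
Proof.
move=> w0 mf; have mw := marginals_freq R w0.
set n := (_ + _)%N; set g := freq R w.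
have -> : 2 * dist n g f = \sum_(t : n.-tuple bool)
    (g t * `|empirical (size w) s t - g s| + `|g t - f t| + f t * dist n g f).
  rewrite !big_split /= empirical_freq // -mulr_suml sum_marginals //.
  by rewrite add0r -/(dist n g f); ring.
apply: ler_sum => t _.
have /andP[e0 e1] := empirical01 (size w) s t.
have := ler_dist mw mf (leq_addl (size w) (size s)); rewrite -/g -/n => h.
have [[_ f0 _ _] [_ g0 _ _]] := (mf, mw).
set E := empirical _ _ _ in e0 e1 *.
have [gs0 gs1] : 0 <= g s /\ g s <= 1.
  split; first exact: g0.
  rewrite -(sum_marginals (size s) mw) (bigD1 (in_tuple s)) //= lerDl.
  by apply: sumr_ge0 => *; exact: g0.
have a1 : `|E - g s| <= 1 by rewrite ler_norml; apply/andP; split; lra.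
have b1 : f t * `|E - f s| <= f t * `|E - g s| + f t * dist n g f.
  by rewrite -mulrDr ler_wpM2l //; apply: le_trans (ler_distD (g s) _ _) _; rewrite lerD2l.
apply: le_trans b1 _; rewrite lerD2r -lerBlDl -mulrBl.
apply: (@le_trans _ _ (`|g t - f t| * `|E - g s|)); last by rewrite ler_piMr.
by rewrite ler_wpM2r// distrC ler_norm.
Qed.

End Fooling.

(** * The limit of the perturbations *)

Section Limit.
Variable R : realType.
Implicit Types (f g : seq bool -> R) (s u v w : seq bool).

(** Summable errors: the sum of [eps j] for [j >= k] is [2 * eps k]. *)
Definition eps (k : nat) : R := 64^-1 * 2^-1 ^+ k.

Lemma eps_gt0 k : 0 < eps k.
Proof. by rewrite mulr_gt0 ?exprn_gt0 ?invr_gt0. Qed.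

Lemma epsS k : 2 * eps k.+1 = eps k.
Proof. by rewrite /eps exprS; field. Qed.

Lemma eps_small e : 0 < e -> \forall k \near \oo, 2 * eps k <= e.
Proof.
move=> e0.
have : eps k @[k --> \oo] --> (0 : R).
  rewrite -[0](mulr0 64^-1); apply: cvgMr; apply: cvg_expr.
  by rewrite ger0_norm; lra.
move=> /cvgr0_norm_le /(_ (e / 2)) H; near=> k.
have : `|eps k| <= e / 2 by near: k; apply: H; rewrite divr_gt0.
by rewrite ger0_norm ?(ltW (eps_gt0 _)) //; lra.
Unshelve. all: end_near. Qed.

(** [n k] is the length of the windows on which the later words must imitate
    [w k]; it exceeds the period of [w k], for ergodicity in the limit, and the
    sample length on which [w k] fools the procedure. *)
Lemma fooling_sequence D : separates R D ->
  exists (w : nat -> seq bool) (n : nat -> nat),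
  forall k, [/\ (0 < size (w k))%N, (size (w k) + k <= n k)%N, (n k <= n k.+1)%N,
    dist (n k) (freq R (w k)) (freq R (w k.+1)) <= eps k &
    exists2 m, (k <= m <= n k.+1)%N &
       1 / 8 <= mean (D m) (freq R (w k.+1)) (freq R (w k.+1))].
Proof.
move=> sepD.
pose T := (seq bool * nat)%type.
pose step (a : nat * T) (b : T) : Prop := (0 < size a.2.1)%N ->
  [/\ (0 < size b.1)%N, (size b.1 + a.1.+1 <= b.2)%N, (a.2.2 <= b.2)%N,
    dist a.2.2 (freq R a.2.1) (freq R b.1) <= eps a.1 &
    exists2 m, (a.1 <= m <= b.2)%N & 1 / 8 <= mean (D m) (freq R b.1) (freq R b.1)].
have /choice[F hF] : forall a, exists b, step a b.
  move=> [k [w n]].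
  have [w0|w0] := boolP (0 < size w)%N; last by exists (w, n); rewrite /step (negPf w0).
  have [w' [m [w'0 nm d h]]] :=
    fooling_perturbation (maxn n k) sepD w0 (eps_gt0 k).
  exists (w', (size w' + k.+1 + n + m)%N) => _ /=; split => //.
  - by lia.
  - by lia.
  - by apply: le_trans d; apply: dist_mono (leq_maxl _ _); exact: marginals_freq.
  - by exists m => //; lia.
pose fix st k : T := if k is k'.+1 then F (k', st k') else ([:: true], 1%N).
have st0 k : (0 < size (st k).1)%N.
  by elim: k => // k IH; have [] := hF (k, st k) IH.
exists (fun k => (st k).1), (fun k => (st k).2) => k.
have [_ _ A B C] := hF (k, st k) (st0 k); split => //.
by case: k {A B C} => // k; have [] := hF (k, st k) (st0 k).
Qed.

(** The process with these marginals contradicts the correctness of [D]. *)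
Lemma fooling_limit D : separates R D ->
  exists f : seq bool -> R, [/\ marginals f, empirically_ergodic f &
    forall N, exists2 m, (N <= m)%N & 1 / 16 <= mean (D m) f f].
Proof.
move=> /fooling_sequence[w [n H]].
pose g k := freq R (w k).
have mg k : marginals (g k) by apply: marginals_freq; case: (H k).
have nk k : (k <= n k)%N by case: (H k) => _; lia.
have tail i k : dist (n k) (g k) (g (k + i)%N) <= 2 * eps k.
  elim: i k => [|i IH] k.
    rewrite addn0 /dist big1 ?mulr_ge0 ?(ltW (eps_gt0 _))// => t _.
    by rewrite subrr normr0.
  apply: le_trans (dist_triangle _ _ (g k.+1) _) _.
  have [_ _ nS d _] := H k.
  have := le_trans (dist_mono (mg k.+1) (mg (k.+1 + i)%N) nS) (IH k.+1).
  rewrite -addSnnS; rewrite epsS -/(g k) -/(g k.+1) in d *; lra.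
(* The bound of tail is uniform in i, hence a Cauchy condition. *)
have cauchy s : cvgn (g^~ s).
  apply: cauchy_cvg; apply: cauchy_exP => e e0; near \oo => k.
  exists (g k s).
  suff : \forall j \near \oo, ball (g k s) e (g j s) by [].
  near=> j; apply: le_lt_trans (_ : 2 * eps k < e); last first.
    have : 2 * eps k <= e / 2 by near: k; apply: eps_small; rewrite divr_gt0.
    by lra.
  have kj : (k <= j)%N by near: j; exact: nbhs_infty_ge.
  have := tail (j - k)%N k; rewrite subnKC // => /(le_trans _); apply.
  apply: ler_dist => //; apply: leq_trans (nk k).
  by near: k; exact: nbhs_infty_ge.
pose f s := limn (g^~ s).
have fE s : g k s @[k --> \oo] --> f s by exact: cauchy.
have df k : dist (n k) (g k) f <= 2 * eps k.
  have : dist (n k) (g k) (g j) @[j --> \oo] --> dist (n k) (g k) f.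
    apply: (cvg_big add_continuous) => t _.
    by apply: cvg_norm; apply: cvgB => //; exact: cvg_cst.
  move=> /cvgr_to_le; apply; near=> j.
  by rewrite -(@subnKC k j) ?tail//; near: j; exact: nbhs_infty_ge.
have mf : marginals f.
  have lim_sum s t u : (forall k, g k s = g k t + g k u) -> f s = f t + f u.
    move=> /funext E; apply: (cvg_unique _ (fE s)) => //.
    by rewrite E; exact: cvgD.
  split.
  - apply: (cvg_unique _ (fE [::])) => //.
    by rewrite (_ : g^~ [::] = cst 1); [exact: cvg_cst|apply/funext => k; case: (mg k)].
  - move=> s; apply: limr_ge; first exact: cauchy.
    by near=> k; case: (mg k).
  - by move=> s; apply: lim_sum => k; case: (mg k).
  - by move=> s; apply: lim_sum => k; case: (mg k).
exists f; split => //.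
- move=> s e e0; near \oo => k.
  have [wk0 wn _ _ _] := H k.
  exists (size (w k)) => //; apply: le_trans (empirical_transfer s wk0 mf) _.
  have nn : (size (w k) + size s <= n k)%N.
    apply: leq_trans wn; rewrite leq_add2l; near: k; exact: nbhs_infty_ge.
  have := le_trans (dist_mono (mg k) mf nn) (df k).
  have : 2 * eps k <= e / 2 by near: k; apply: eps_small; rewrite divr_gt0.
  rewrite -/(g k); lra.
- move=> N; have [_ _ _ _ [m /andP[Nm mn] h]] := H N; exists m => //.
  have := mean_lipschitz (D m) (mg N.+1) mf.
  have := le_trans (dist_mono (mg N.+1) mf mn) (df N.+1).
  have : eps N.+1 <= 64^-1 by rewrite ler_piMr// exprn_ile1 //; lra.
  rewrite -/(g _) in h *; lra.
Unshelve. all: end_near. Qed.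

End Limit.

(** * Cylinders *)

Definition cylinder (s : seq bool) : set binseq :=
  [set x | window x 0 (size s) = s].

Lemma measurable_coord d (T : measurableType d) (X : T -> binseq) :
  (forall i, measurable (X^~ i @^-1` [set true])) -> measurable_fun setT X.
Proof.
move=> mX; apply: (@measurability _ _ _ binseq setT X coord_sets) => //.
move=> _ [_ [i [B mB ->]] <-].
have : measurable_fun setT (X^~ i).
  by apply: (measurable_fun_bool true); rewrite setTI.
by move=> /(_ measurableT B mB).
Qed.

Lemma measurable_coord1 i b : measurable [set x : binseq | x i = b].
Proof.
apply: sub_sigma_algebra; exists i, [set b]; first by [].
by apply/seteqP; split.
Qed.

Lemma measurable_window i s : measurable [set x : binseq | window x i (size s) = s].
Proof.
elim: s i => [|b s IH] i /=.
  by rewrite (_ : mkset _ = setT) //; apply/seteqP; split.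
rewrite (_ : mkset _ = [set x : binseq | x i = b] `&` [set x : binseq | window x i.+1 (size s) = s]).
  by apply: measurableI => //; exact: measurable_coord1.
by apply/seteqP; split => x /=; rewrite windowS => -[-> ->].
Qed.

Lemma measurable_cylinder s : measurable (cylinder s).
Proof. exact: measurable_window. Qed.

Lemma first_nE n x (t : n.-tuple bool) : first_n n x = t <-> cylinder t x.
Proof.
have E : first_n n x = window x 0 n :> seq bool.
  by rewrite /first_n /= /window -val_enum_ord -map_comp.
rewrite /cylinder /= size_tuple -E; split => [->//|]; exact: val_inj.
Qed.

Lemma measure_fibers d (T : measurableType d) (R : realType)
    (mu : {measure set T -> \bar R}) (I : finType) (X : T -> I) (A : set T) :
  (forall i, measurable (X @^-1` [set i])) -> measurable A ->
  (mu A = \sum_i mu (A `&` X @^-1` [set i]))%E.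
Proof.
move=> mX mA; rewrite -big_enum /= fsbig_seq ?enum_uniq // -measure_fin_bigcup //; last 2 first.
- apply/trivIsetP => i j _ _ /eqP ij; apply/seteqP; split => // x [[_ hi] [_ hj]].
  by apply: ij; rewrite -hi -hj.
- by move=> i _; exact: measurableI.
congr (mu _); apply/seteqP; split => [x Ax|x [i _ []]] //.
by exists (X x); rewrite /= ?mem_enum.
Qed.

Lemma measurable_shift : measurable_fun setT shift_seq.
Proof.
by apply: measurable_coord => i; exact: (measurable_coord1 i.+1 true).
Qed.

(** The empty set is included to make the family closed under intersection. *)
Definition cylinders : set (set binseq) :=
  [set A | A = set0 \/ exists s, A = cylinder s].

Lemma cylinder_nil : cylinder [::] = setT.
Proof. by apply/seteqP; split. Qed.

(** A cylinder of length [n] determines all the windows inside [0, n). *)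
Lemma setI_window i s n (t : n.-tuple bool) : (i + size s <= n)%N ->
  [set x : binseq | window x i (size s) = s] `&` cylinder t =
  if take (size s) (drop i t) == s then cylinder t else set0.
Proof.
move=> le.
have E x : cylinder t x -> window x i (size s) = take (size s) (drop i t).
  by rewrite /cylinder /= size_tuple => <-; rewrite sub_window.
case: eqP => h; apply/seteqP; split => x //=.
- by case.
- by move=> xt; split => //; rewrite E.
- by case=> xs xt; apply: h; rewrite -(E x).
Qed.

Lemma setI_cylinders : setI_closed cylinders.
Proof.
move=> A B [->|[s ->]]; first by left; rewrite set0I.
case=> [->|[t ->]]; first by left; rewrite setI0.
wlog st : s t / (size s <= size t)%N => [H|].
  by case/orP: (leq_total (size s) (size t)) => /H //; rewrite setIC.
have := @setI_window 0 s _ (in_tuple t); rewrite add0n => /(_ st) ->.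
by case: ifP => _; [right; exists t|left].
Qed.

Lemma measurable_cylinders : @measurable _ binseq = <<s cylinders >>.
Proof.
apply/seteqP; split; last first.
  apply: smallest_sub; first exact: sigma_algebra_measurable.
  by move=> _ [->|[s ->]]; [exact: measurable0|exact: measurable_cylinder].
apply: smallest_sub; first exact: smallest_sigma_algebra.
move=> _ [i [B _ ->]].
pose F s : set (g_sigma_algebraType cylinders) :=
  if (size s == i.+1) && (nth false s i \in B) then cylinder s else set0.
rewrite (_ : _ @^-1` _ = \bigcup_s F s).
  apply: (@countable_bigcupT_measurable _ (g_sigma_algebraType cylinders)) => // s.
  by apply: sub_sigma_algebra; rewrite /F; case: ifP => _; [right; exists s|left].
have nthw x : nth false (window x 0 i.+1) i = x i.
  by rewrite (nth_map 0%N) ?size_iota // nth_iota.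
apply/seteqP; split => [x Bx|x [s _]].
  exists (window x 0 i.+1) => //.
  by rewrite /F size_window eqxx nthw mem_set //= /cylinder /= size_window.
rewrite /F; case: ifP => // /andP[/eqP ss /set_mem Bs] /=.
by rewrite /cylinder /= ss => E; rewrite /preimage /= -nthw E.
Qed.

(** * A process with given marginals *)

Section Realization.
Variable R : realType.
Variable f : seq bool -> R.
Hypothesis mf : marginals f.

(** The words of length [n], in lexicographic order, cut [0, 1) into consecutive
    intervals [left_end s, left_end s + f s): before [s] come the words that
    branch off to the left of [s]. *)
Definition left_end (s : seq bool) : R :=
  \sum_(i < size s) (if nth false s i then f (rcons (take i s) false) else 0).

Lemma left_end_rcons s b :
  left_end (rcons s b) = left_end s + (if b then f (rcons s false) else 0).
Proof.
rewrite /left_end size_rcons big_ord_recr /= nth_rcons ltnn eqxx.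
have -> : take (size s) (rcons s b) = s by rewrite -cats1 take_size_cat.
congr (_ + _); apply: eq_bigr => i _; rewrite nth_rcons ltn_ord.
by have -> : take i (rcons s b) = take i s by rewrite -cats1 takel_cat // ltnW.
Qed.

(** For [u] in [0, 1), the word of length [n] whose interval contains [u]. *)
Fixpoint prefix_of (u : R) n : seq bool :=
  if n is m.+1 then let s := prefix_of u m in
    rcons s (left_end (rcons s true) <= u) else [::].

Definition expansion (u : R) : binseq :=
  fun n => left_end (rcons (prefix_of u n) true) <= u.

Lemma window_expansion u n : window (expansion u) 0 n = prefix_of u n.
Proof. by elim: n => // n IH; rewrite windowSr IH. Qed.

Lemma measurable_prefix_of n s : measurable [set u | prefix_of u n = s].
Proof.
elim: n s => [|n IH] s /=.
  by case: s => [|b s]; [rewrite (_ : mkset _ = setT)|rewrite (_ : mkset _ = set0)];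
   rewrite ?measurableT //; apply/seteqP; split.
case/lastP: s => [|s b].
  rewrite (_ : mkset _ = set0) //; apply/seteqP; split => // u.
  by rewrite /mkset => /(congr1 size); rewrite size_rcons.
rewrite (_ : mkset _ = [set u | prefix_of u n = s] `&`
  [set u | (left_end (rcons s true) <= u) = b]).
  apply: measurableI => //.
  case: b.
    rewrite (_ : mkset _ = `[left_end (rcons s true), +oo[%classic) //.
    by apply/seteqP; split => u; rewrite /= in_itv /= andbT.
  rewrite (_ : mkset _ = `]-oo, left_end (rcons s true)[%classic) //.
  by apply/seteqP; split => u; rewrite /= in_itv /= ltNge; case: (_ <= u).
by apply/seteqP; split => u /=; [move=> /rcons_inj[-> ->]|case=> -> ->].
Qed.

(** The [i]-th letter compares [u] with a threshold that depends on the prefix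
    only, and there are countably many prefixes. *)
Lemma measurable_expansion : measurable_fun setT expansion.
Proof.
apply: measurable_coord => i.
rewrite (_ : _ @^-1` _ = \bigcup_s ([set u | prefix_of u i = s] `&`
    `[left_end (rcons s true), +oo[%classic)).
  apply: countable_bigcupT_measurable => // s; apply: measurableI => //.
  exact: measurable_prefix_of.
apply/seteqP; split => [u h|u [s _ [<-]]].
  by exists (prefix_of u i) => //; split => //; rewrite /= in_itv /= andbT.
by rewrite /= in_itv /= andbT.
Qed.

Lemma left_end_itv s : 0 <= left_end s /\ left_end s + f s <= 1.
Proof.
have [f1 f0 fr _] := mf.
elim/last_ind: s => [|s b [IH0 IH1]].
  by rewrite /left_end big_ord0 f1; lra.
rewrite left_end_rcons; have := fr s; have := f0 (rcons s true).
have := f0 (rcons s false); case: b; lra.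
Qed.

Lemma prefix_of_itv u n s : size s = n -> 0 <= u < 1 ->
  (prefix_of u n = s) <-> (left_end s <= u < left_end s + f s).
Proof.
have [f1 f0 fr _] := mf.
move=> <- u01; elim/last_ind: s => [|s b IH].
  by rewrite /left_end big_ord0 f1 add0r.
rewrite size_rcons /=; split.
  move=> /rcons_inj[E]; rewrite E !left_end_rcons => Eb.
  have /andP[h1 h2] := IH.1 E; rewrite -Eb.
  by have := fr s; case: ifP => h; lra.
rewrite left_end_rcons => h; have E : prefix_of u (size s) = s.
  apply/IH; have := fr s; have := f0 (rcons s true).
  by have := f0 (rcons s false); case: b h; lra.
rewrite E left_end_rcons; congr rcons.
by case: b h => h; apply/idP; lra.
Qed.

Definition interval_law : set binseq -> \bar R :=
  pushforward (mrestr (@lebesgue_measure R) (measurable_itv `[0 : R, 1[)) expansion.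

Let interval_measure : {measure set binseq -> \bar R} :=
  measure_function_pushforward__canonical__measure_function_Measure
    (mrestr (@lebesgue_measure R) (measurable_itv `[0 : R, 1[)) measurable_expansion.

HB.instance Definition _ := isMeasure.Build _ _ _ interval_law
  (measure0 interval_measure) (measure_ge0 interval_measure)
  (@measure_semi_sigma_additive _ _ _ interval_measure).

Let interval_law1 : interval_law setT = 1%E.
Proof.
rewrite /interval_law /pushforward preimage_setT /mrestr setTI.
by rewrite lebesgue_measure_itv /= lte_fin ltr01 oppr0 adde0.
Qed.

HB.instance Definition _ := Measure_isProbability.Build _ _ _ interval_law interval_law1.

(** Kolmogorov extension for binary sequences: the random expansion of a
    uniform point of [0, 1) starts with [s] exactly on an interval of length
    [f s]. *)
Lemma realization : exists P : process R, forall s, P (cylinder s) = (f s)%:E.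
Proof.
have [_ f0 _ _] := mf.
exists interval_law => s.
rewrite /= /interval_law /pushforward /mrestr.
rewrite (_ : _ `&` _ = `[left_end s, left_end s + f s[%classic).
  rewrite lebesgue_measure_itv /= lte_fin ltrDl.
  case: ltrP => h; first by rewrite -EFinB addrAC subrr add0r.
  by congr (_%:E); apply/eqP; rewrite eq_le h f0.
have [l0 l1] := left_end_itv s.
apply/seteqP; split => u /=; rewrite /cylinder /= window_expansion !in_itv /=.
  by case=> E u01; apply/(prefix_of_itv (erefl _) u01).
move=> h; have u01 : 0 <= u < 1 by lra.
by split => //; apply/(prefix_of_itv (erefl _) u01).
Qed.

End Realization.

(** * Stationarity, ergodicity and mean output from the marginals *)

Section Processes.
Variable R : realType.
Implicit Types (P Q : process R) (f g : seq bool -> R).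

Lemma measure_cylinder_unique (m1 m2 : {measure set binseq -> \bar R}) :
  (m1 setT < +oo)%E -> (forall s, m1 (cylinder s) = m2 (cylinder s)) ->
  forall A, measurable A -> m1 A = m2 A.
Proof.
move=> fin H A mA.
apply: (@measure_unique _ R binseq cylinders (fun=> setT)) => //.
- exact: measurable_cylinders.
- exact: setI_cylinders.
- by move=> _; right; exists [::]; rewrite cylinder_nil.
- by rewrite bigcup_const //; exists 0%N.
- by move=> _ [->|[s ->]]; rewrite ?measure0.
Qed.

Lemma measure_split (mu : {measure set binseq -> \bar R}) n (A : set binseq) :
  measurable A -> (mu A = \sum_(t : n.-tuple bool) mu (A `&` cylinder t))%E.
Proof.
move=> mA; have E (t : n.-tuple bool) : first_n n @^-1` [set t] = cylinder t.
  by apply/seteqP; split => x /= /first_nE.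
rewrite (measure_fibers mu (X := first_n n)) // => [|t].
  by apply: eq_bigr => t _; rewrite E.
by rewrite E; exact: measurable_cylinder.
Qed.

Definition has_marginals P f := forall s, P (cylinder s) = (f s)%:E.

(** The preimage of a cylinder by the shift is a union of two cylinders, over
    the first letter. *)
Lemma stationary_marginals P f : marginals f -> has_marginals P f -> stationary P.
Proof.
move=> [_ _ _ fl] Pf A mA.
apply: (measure_cylinder_unique
  (m1 := measure_function_pushforward__canonical__measure_function_Measure
           P measurable_shift) (m2 := P)) => //.
  by rewrite /= /pushforward preimage_setT probability_setT ltry.
move=> s; rewrite /= /pushforward.
have E b : shift_seq @^-1` cylinder s `&` (fun x : binseq => x 0%N) @^-1` [set b]
    = cylinder (b :: s).
  have sh (x : binseq) : window (shift_seq x) 0 (size s) = window x 1 (size s).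
    exact: eq_window.
  apply/seteqP; split => x; rewrite /cylinder /= sh windowS; first by case=> -> ->.
  by case=> -> ->.
rewrite (measure_fibers P (X := fun x : binseq => x 0%N)) => [|b|].
- by rewrite big_bool !E /= !Pf (fl s) EFinD addeC.
- exact: (measurable_coord1 0 b).
- by rewrite -[X in measurable X]setTI; apply: measurable_shift => //; exact: measurable_cylinder.
Qed.

(** Let [A] be invariant. By stationarity the probability of [A] and an
    occurrence of [s] at position [i] does not depend on [i]; averaging over
    [i] replaces the occurrence by the empirical frequency of [s], which is
    nearly constant.  So [A] is independent of all cylinders, hence of
    itself. *)
Lemma ergodic_marginals P f : marginals f -> has_marginals P f ->
  empirically_ergodic f -> ergodic P.
Proof.
move=> mf Pf ef A mA inv.
have statP := stationary_marginals mf Pf.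
pose W i s : set binseq := [set x | window x i (size s) = s].
pose p B := fine (P B).
have pE B : measurable B -> P B = (p B)%:E.
  by move=> mB; rewrite /p fineK // fin_num_measure.
have mAW i s : measurable (A `&` W i s) by apply: measurableI => //; exact: measurable_window.
have shiftW i s : p (A `&` W i s) = p (A `&` cylinder s).
  elim: i => // i <-; rewrite /p -(statP (A `&` W i s)) //; congr (fine (P _)).
  rewrite preimage_setI inv; congr (_ `&` _).
  have sh (x : binseq) : window x i.+1 (size s) = window (shift_seq x) i (size s).
    exact: eq_window.
  by apply/seteqP; split => x; rewrite /W /preimage /= sh.
have splitp n B : measurable B -> p B = \sum_(t : n.-tuple bool) p (B `&` cylinder t).
  move=> mB; apply: EFin_inj; rewrite -sumEFin -pE // (measure_split P n mB).
  by apply: eq_bigr => t _; rewrite /= pE //; apply: measurableI => //; exact: measurable_cylinder.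
have pf (t : seq bool) : p (A `&` cylinder t) <= f t.
  rewrite -lee_fin -pE -?Pf; last by apply: measurableI => //; exact: measurable_cylinder.
  apply: le_measure; rewrite ?inE; [|exact: measurable_cylinder|exact: subIsetr].
  by apply: measurableI => //; exact: measurable_cylinder.
have p0 B : 0 <= p B by rewrite fine_ge0.
have emp m s : (0 < m)%N -> p (A `&` cylinder s) =
    \sum_(t : (m + size s).-tuple bool) p (A `&` cylinder t) * empirical R m s t.
  move=> m0; have m0' : m%:R != 0 :> R by rewrite pnatr_eq0 -lt0n.
  apply: (mulIf m0').
  transitivity (\sum_(i < m) p (A `&` W i s)).
    by under eq_bigr => i _ do rewrite shiftW; rewrite sumr_const card_ord mulr_natr.
  rewrite mulr_suml; under [RHS]eq_bigr => t _ do
    rewrite -mulrA /empirical divfK // mulr_sumr.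
  rewrite exchange_big /=; apply: eq_bigr => i _.
  rewrite (splitp (m + size s)%N) //; apply: eq_bigr => t _.
  rewrite -setIA setI_window; last by have := ltn_ord i; lia.
  by case: eqP => _; rewrite ?mulr1 // setI0 mulr0 /p measure0.
(* Both sides are finite sums over the cylinders of length m + size s, on which
   the probability of A is at most f. *)
have indep s : p (A `&` cylinder s) = p A * f s.
  apply/eqP/negPn/negP => ne.
  have e0 : 0 < `|p (A `&` cylinder s) - p A * f s| by rewrite normr_gt0 subr_eq0.
  have [m m0 hm] := ef s _ (divr_gt0 e0 (ltr0Sn R 1)).
  have : `|p (A `&` cylinder s) - p A * f s| <=
    \sum_(t : (m + size s).-tuple bool) f t * `|empirical R m s t - f s|.
    rewrite (emp m s) // {1}(splitp (m + size s)%N A mA) mulr_suml -sumrB.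
    apply: le_trans (ler_norm_sum _ _ _) _; apply: ler_sum => t _.
    by rewrite -mulrBr normrM ger0_norm // ler_wpM2r.
  lra.
(* Two finite measures, P restricted to A and P scaled by P A, agree on
   cylinders; evaluate them at A. *)
have : p A = p A * p A.
  have pA0 : 0 <= p A := p0 A.
  have unique := measure_cylinder_unique (m1 := mrestr P mA)
     (m2 := mscale (NngNum pA0) P).
  have /unique H : (mrestr P mA setT < +oo)%E.
    by rewrite /mrestr setTI pE // ltry.
  have {H} := H _ A mA; rewrite /= /mrestr /mscale /= setIid (pE A mA) -EFinM => H.
  apply: EFin_inj; apply: H => s.
  rewrite setIC pE; last by apply: measurableI => //; exact: measurable_cylinder.
  by rewrite indep Pf.
rewrite pE // => /eqP; rewrite -[X in X == _]mulr1 -subr_eq0 -mulrBr mulf_eq0 subr_eq0.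
by case/orP => /eqP E; [left; rewrite E|right; rewrite -E].
Qed.

Lemma mean_outputE D P Q f g n : has_marginals P f -> has_marginals Q g ->
  mean_output D P Q n = (mean (D n) f g)%:E.
Proof.
move=> Pf Qg; rewrite /mean_output.
pose S := [set w : binseq * binseq | D n (first_n n w.1) (first_n n w.2)].
pose X (w : binseq * binseq) := (first_n n w.1, first_n n w.2).
have XE (s t : n.-tuple bool) : X @^-1` [set (s, t)] = cylinder s `*` cylinder t.
  apply/seteqP; split => -[x y] /=.
    by case=> /first_nE ? /first_nE ?.
  by case=> /first_nE ? /first_nE ?; rewrite /X /=; congr pair.
have mX st : measurable (X @^-1` [set st]).
  by case: st => s t; rewrite XE; apply: measurableX; exact: measurable_cylinder.
have mS : measurable S.
  rewrite (_ : S = \bigcup_(st in [set st | D n st.1 st.2]) X @^-1` [set st]).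
    by apply: fin_bigcup_measurable.
  apply/seteqP; split => [w h|w [st h E]]; first by exists (X w).
  by rewrite /= -E in h.
have SE w : (w \in S) = D n (first_n n w.1) (first_n n w.2).
  by apply/idP/idP => [/set_mem//|h]; exact/mem_set.
rewrite (_ : (fun w => _) = \1_S); last first.
  by apply/funext => w; rewrite indicE SE.
rewrite expectation_indic // (measure_fibers _ mX mS).
pose G s t := (P \x Q)%E (S `&` X @^-1` [set (s, t)]).
rewrite (eq_bigr (fun st => G st.1 st.2)) => [|[s t] _ //].
rewrite -(pair_bigA _ G) /=.
rewrite /mean -sumEFin; apply: eq_bigr => s _; rewrite -sumEFin; apply: eq_bigr => t _.
rewrite /G; have -> : S `&` X @^-1` [set (s, t)] = if D n s t then cylinder s `*` cylinder t else set0.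
  rewrite -XE; apply/seteqP; split => w /=.
    by case=> h E; move: h; rewrite /S /=; case: (E) => -> -> ->.
  by case: ifP => // h E; split => //; rewrite /S /=; case: E => -> ->.
case: (D n s t) => /=; last by rewrite measure0 mulr0.
rewrite product_measure1E ?mulr1 ?EFinM -?Pf -?Qg //; exact: measurable_cylinder.
Qed.

End Processes.

Theorem corollary1 (R : realType) :
  ~ exists D : discrimination_procedure,
      asymptotically_correct D (@stationary_ergodic R).
Proof.
move=> [D ac].
have se P f : marginals f -> empirically_ergodic f -> has_marginals P f ->
    @stationary_ergodic R P.
  by move=> mf ef Pf; split; [exact: stationary_marginals Pf|exact: ergodic_marginals ef].
have sep : separates R D.
  move=> u v u0 v0 uv N.
  have proc w : (0 < size w)%N -> exists2 P : process R, stationary_ergodic P &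
      has_marginals P (freq R w).
    move=> w0; have mw := marginals_freq R w0; have [P HP] := realization mw.
    exists P => //; apply: (se _ _ mw) HP => s e e0; exists (size w) => //.
    by rewrite empirical_freq // ltW.
  have [[P sP Pu] [Q sQ Qv]] := (proc _ u0, proc _ v0).
  have := ac P Q sP sQ; rewrite asboolF; last first.
    move=> /(_ _ (measurable_cylinder [:: true])); rewrite /= Pu Qv => -[] /eqP.
    by rewrite (negPf uv).
  rewrite (_ : mean_output D P Q = fun n => (mean (D n) (freq R u) (freq R v))%:E); last first.
    by apply/funext => n; rewrite (mean_outputE _ _ Pu Qv).
  move=> /fine_cvgP[_ /= /cvgr_ge] /(_ (3 / 4)) h; near \oo => m.
  exists m; first by near: m; exact: nbhs_infty_ge.
  by near: m; apply: h; lra.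
have [f [mf ef hf]] := fooling_limit sep.
have [P Pf] := realization mf.
have sP := se _ _ mf ef Pf.
have := ac P P sP sP; rewrite asboolT //.
rewrite (_ : mean_output D P P = fun n => (mean (D n) f f)%:E); last first.
  by apply/funext => n; rewrite (mean_outputE _ _ Pf Pf).
move=> /fine_cvgP[_ /= /cvgr_le] /(_ (1 / 32)) h.
have [N _ HN] : \forall m \near \oo, mean (D m) f f <= 1 / 32 by apply: h; lra.
have [m Nm hm] := hf N; have := HN m Nm; rewrite /=; lra.
Unshelve. all: end_near. Qed.
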